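(* Let $k\ge 1$ be an integer. If $T$ is a tree of diameter $d\ge 2k$, then for every family of graphs $\mathcal{F}$ (each graph in $\mathcal{F}$ containing at least one edge) with $\mathrm{ex}(n,T,\mathcal{F})=o(n^{k+1})$, we have \[ \mathrm{ex}(n,T,\mathcal{F})=O\left(n^{k+\frac{k(k-1)}{d-k}}\right). \]
   Context: All graphs are finite and simple. For a family of graphs $\mathcal{F}$, a graph is $\mathcal{F}$-free if it contains no member of $\mathcal{F}$ as a (not necessarily induced) subgraph. For a graph $H$, $\mathrm{ex}(n,H,\mathcal{F})$ is the maximum number of copies of $H$ (subgraphs isomorphic to $H$) in an $n$-vertex $\mathcal{F}$-free graph. The diameter of a tree is the number of edges of a longest path in it. Asymptotic notation is as $n\to\infty$ with $T,k,\mathcal{F}$ fixed. *)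

(* Defs.v *)
From mathcomp Require Import all_boot boolp.

Set Implicit Arguments.
Unset Strict Implicit.
Unset Printing Implicit Defensive.

Local Open Scope nat_scope.

Record sgraph := SGraph {
  vertex :> finType;
  adj : rel vertex;
  adj_sym : symmetric adj;
  adj_irrefl : irreflexive adj }.

Arguments adj {s} : rename.

Definition edges (G : sgraph) : {set {set G}} :=
  [set e : {set G} | [exists x : G, exists y : G, adj x y && (e == [set x; y])]].

(* A subgraph is given by its vertex set S.1 and its edge set S.2. *)
Definition is_subgraph (G : sgraph) (S : {set G} * {set {set G}}) : bool :=
  (S.2 \subset edges G) && [forall e in S.2, e \subset S.1].

Definition subgraph_iso (H G : sgraph) (S : {set G} * {set {set G}}) : bool :=
  [exists f : {ffun H -> G},
    [&& injectiveb f, f @: [set: H] == S.1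
      & [forall x : H, forall y : H, adj x y == ([set f x; f y] \in S.2)]]].

Definition copies (H G : sgraph) : {set {set G} * {set {set G}}} :=
  [set S | is_subgraph S && subgraph_iso H S].

Definition is_free (F : sgraph -> Prop) (G : sgraph) : Prop :=
  forall H : sgraph, F H -> copies H G = set0.

Section EdgeGraph.
Variables (n : nat) (E : {set {set 'I_n}}).

Definition edge_adj : rel 'I_n := fun x y => (x != y) && ([set x; y] \in E).

Lemma edge_adj_sym : symmetric edge_adj.
Proof. by move=> x y; rewrite /edge_adj eq_sym setUC. Qed.

Lemma edge_adj_irrefl : irreflexive edge_adj.
Proof. by move=> x; rewrite /edge_adj eqxx. Qed.

Definition edge_graph : sgraph := SGraph edge_adj_sym edge_adj_irrefl.
End EdgeGraph.

(* Every graph on n vertices is isomorphic to edge_graph E for some E, so the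
   maximum below ranges over all n-vertex F-free graphs up to isomorphism
   (elements of E that are not pairs are ignored by edge_graph). *)
Definition extremal (n : nat) (H : sgraph) (F : sgraph -> Prop) : nat :=
  \max_(E : {set {set 'I_n}} | `[< is_free F (edge_graph E) >])
    #|copies H (edge_graph E)|.

Definition is_tree (T : sgraph) : Prop :=
  [/\ 0 < #|T|,
      forall x y : T, connect adj x y
    & forall c : seq T, 2 < size c -> ~ ucycle adj c].

Definition has_path (G : sgraph) (m : nat) : bool :=
  [exists x : G, exists p : m.-tuple G, path adj x p && uniq (x :: p)].

(* A path with m edges has m.+1 vertices, whence the bound m < #|T|. *)
Definition diameter (T : sgraph) : nat := \max_(m < #|T| | has_path T m) m.

(* Main.v *)
Require Import Defs.
From mathcomp Require Import all_boot boolp zify.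

(** Write [h] for the number of vertices of [T], [m] for that of a free graph [G],
    and [e] for the number of its (ordered) adjacent pairs.

    The growth hypothesis forbids blow-ups. Take pairwise disjoint, pairwise
    non-adjacent subtrees of [T], [k + 1] of them, and replace each by [t] disjoint
    copies, attached in the same way. The result has [O(t)] vertices and at least
    [t ^ (k + 1)] copies of [T], so for some [t] it does not embed in any free graph
    ([forbidden_blowup]).

    Fix a copy of [T] in a free graph [G], and call a subtree of [T] blowable if it can
    be moved in many disjoint ways while the rest of the copy stays in place.
    Then no [k + 1] blowable subtrees are pairwise separated (disjoint and
    non-adjacent), as these would assemble to a forbidden blow-up
    ([blowup_embedding]). In a tree this entails that some [k] edges touch all
    blowable subtrees ([subtree_edge_cover]). The images of these [k] edges leave
    only a bounded number of possibilities for the copy, by the sunflower lemma: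
    too many copies with the same images would produce a blowable subtree which
    the [k] edges do not touch. So [G] has at most [K * e ^ k] copies of [T]
    ([card_embeddings_bound], [card_embeddings_free]).

    Conversely, a graph whose degrees are all at least a constant times [e / m], with
    [e / m] large, has at least about [m * (e / m) ^ (h - 1)] copies of [T], which
    is at least [m * (e / m) ^ d] as [d < h]. A free graph that violates
    [e ^ (d - k) <= C * m ^ (d - 1)] and has the fewest vertices satisfies this degree
    condition, and comparing the two counts shows that there is none, once [C] is
    large ([edge_bound]).

    Inserting this bound in [K * e ^ k] gives the exponent [k * (d - 1) / (d - k)],
    which equals [k + k * (k - 1) / (d - k)]. *)

Set Implicit Arguments.
Unset Strict Implicit.
Unset Printing Implicit Defensive.

(** * Copies and embeddings *)

Definition embeddings (H G : sgraph) : {set {ffun H -> G}} :=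
  [set f : {ffun H -> G} | injectiveb f &&
     [forall x, forall y, adj x y ==> adj (f x) (f y)]].

Lemma embeddingsP (H G : sgraph) (f : {ffun H -> G}) :
  reflect (injective f /\ forall x y, adj x y -> adj (f x) (f y))
          (f \in embeddings H G).
Proof.
rewrite inE; apply: (iffP andP) => [[/injectiveP fI /forallP fA]|[fI fA]].
  by split=> // x y; apply/implyP; move/forallP: (fA x); apply.
split; first exact/injectiveP.
by apply/forallP=> x; apply/forallP=> y; apply/implyP; apply: fA.
Qed.

Definition copy_of (H G : sgraph) (f : {ffun H -> G}) :
    {set G} * {set {set G}} :=
  (f @: [set: H],
   [set [set f e.1; f e.2] | e in [set e : H * H | adj e.1 e.2]]).

Lemma eq_set2 (V : finType) (a b c d : V) :
  [set a; b] = [set c; d] -> a = c /\ b = d \/ a = d /\ b = c.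
Proof.
move=> E.
have: a \in [set c; d] by rewrite -E set21.
have: b \in [set c; d] by rewrite -E set22.
have: c \in [set a; b] by rewrite E set21.
have: d \in [set a; b] by rewrite E set22.
by move=> /set2P[] ? /set2P[] ? /set2P[] ? /set2P[] ?; subst; auto.
Qed.

Lemma copies_embeddings (H G : sgraph) :
  copies H G = (@copy_of H G) @: embeddings H G.
Proof.
apply/setP=> -[W D]; apply/idP/imsetP => [|[f /embeddingsP[fI fA]] [-> ->]].
  rewrite inE => /andP[/andP[/subsetP sDG /forall_inP sDW] /existsP[f]].
  case/and3P=> /injectiveP fI /eqP/= fW /forallP/= fD; exists f.
    apply/embeddingsP; split=> // x y xy.
    have /forallP/(_ y)/eqP := fD x; rewrite xy => /esym/sDG.
    rewrite inE => /existsP[u /existsP[v /andP[uv /eqP]]].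
    by case/eq_set2=> -[-> ->] //; rewrite adj_sym.
  rewrite /copy_of fW /=; congr pair; apply/setP=> e.
  apply/idP/imsetP => [eD|[[x y]]]; last first.
    by rewrite inE /= => xy ->; have /forallP/(_ y)/eqP <- := fD x.
  have := sDG _ eD; rewrite inE => /existsP[u /existsP[v /andP[uv /eqP Ee]]].
  have /subsetP sW := sDW _ eD.
  have: u \in W by apply: sW; rewrite Ee set21.
  have: v \in W by apply: sW; rewrite Ee set22.
  rewrite -fW => /imsetP[y _ Ev] /imsetP[x _ Eu]; exists (x, y) => /=.
    by rewrite inE /=; have /forallP/(_ y)/eqP -> := fD x; rewrite -Eu -Ev -Ee.
  by rewrite -Eu -Ev.
rewrite inE /is_subgraph /subgraph_iso /=; apply/andP; split.
  apply/andP; split.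
    apply/subsetP=> z /imsetP[[x y]]; rewrite !inE /= => xy ->.
    by apply/existsP; exists (f x); apply/existsP; exists (f y); rewrite fA /=.
  apply/forall_inP=> _ /imsetP[[x y] _ ->] /=.
  by apply/subsetP=> z; rewrite !inE => /orP[]/eqP->; apply: imset_f.
apply/existsP; exists f; apply/and3P; split=> //; first exact/injectiveP.
apply/forallP=> x; apply/forallP=> y; apply/eqP.
apply/idP/imsetP => [xy|[[u v]]]; first by exists (x, y); rewrite ?inE.
rewrite inE /= => uv /eq_set2[][/fI-> /fI->] //.
by rewrite adj_sym.
Qed.

Lemma leq_copies_embeddings (H G : sgraph) :
  #|copies H G| <= #|embeddings H G|.
Proof. by rewrite copies_embeddings leq_imset_card. Qed.

Lemma leq_card_copies (I : finType) (H G : sgraph) (f : I -> {ffun H -> G}) :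
  (forall i, f i \in embeddings H G) ->
  injective (fun i => f i @: [set: H]) -> #|I| <= #|copies H G|.
Proof.
move=> fE fI.
have /card_imset <- : injective (fun i => copy_of (f i)).
  by move=> i j [] /fI.
rewrite subset_leq_card //; apply/subsetP=> _ /imsetP[i _ ->].
by rewrite copies_embeddings imset_f.
Qed.

(** Being free is inherited by everything that embeds, since copies push forward
    along embeddings. *)
Lemma is_free_embedding (F : sgraph -> Prop) (G G' : sgraph) (f : G -> G') :
  injective f -> (forall x y, adj x y -> adj (f x) (f y)) ->
  is_free F G' -> is_free F G.
Proof.
move=> fI fA G'F H FH; apply/eqP; rewrite -subset0; apply/subsetP=> S.
rewrite copies_embeddings => /imsetP[g /embeddingsP[gI gA] _].
have := G'F H FH; rewrite copies_embeddings => /setP.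
move=> /(_ (copy_of [ffun x => f (g x)])); rewrite in_set0 imset_f //.
apply/embeddingsP; split=> [x y|x y /gA/fA]; rewrite !ffunE //.
by move=> /fI/gI.
Qed.

(** * Trees and their subtrees *)

(** The most recently added vertex comes first: a tree is built by attaching each
    new vertex to exactly one earlier one. *)
Fixpoint tree_order (T : sgraph) (s : seq T) : Prop :=
  if s is x :: s' then
    [/\ x \notin s', s' = [::] \/ (exists2 y, y \in s' & adj x y),
        forall y z, y \in s' -> z \in s' -> adj x y -> adj x z -> y = z
      & tree_order s']
  else True.

Lemma tree_order_uniq (T : sgraph) (s : seq T) : tree_order s -> uniq s.
Proof. by elim: s => //= x s IH [-> _ _ /IH]. Qed.

Lemma tree_orderP (T : sgraph) :
  is_tree T -> exists s : seq T, tree_order s /\ forall x, x \in s.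
Proof.
case=> T_gt0 Tconn Tacyc.
have [x0 _] : exists x0 : T, x0 \in T by apply/card_gt0P.
pose linked (s : seq T) := forall a b, a \in s -> b \in s ->
  exists p, [/\ path adj a p, last a p = b & {subset a :: p <= s}].
suff grow n : n < #|T| ->
    exists s : seq T, [/\ tree_order s, size s = n.+1 & linked s].
  have [|s [sT sz _]] := grow #|T|.-1; first by rewrite prednK.
  exists s; split=> // x; rewrite prednK // in sz.
  have /subset_cardP : #|s| = #|T|.
    by rewrite (card_uniqP (tree_order_uniq sT)).
  by move=> /(_ (subset_predT _)) ->.
elim: n => [_|n IH n1T].
  exists [:: x0]; split=> //=; first by split=> //; left.
  move=> a b; rewrite !inE => /eqP-> /eqP->; exists [::].
  by split=> // c; rewrite !inE.
have [s [sT sz sL]] := IH (ltnW n1T).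
have [x [y [xs ys xy]]] : exists x y, [/\ x \notin s, y \in s & adj x y].
  have [z zs] : exists z, z \notin s.
    apply/existsP; rewrite -negb_forall; apply/negP => /forallP sP.
    have : #|T| <= #|s| by rewrite subset_leq_card //; apply/subsetP.
    by rewrite (card_uniqP (tree_order_uniq sT)) sz leqNgt n1T.
  have [a sa] : exists a, a \in s.
    by case: (s) sz => // a s' _; exists a; rewrite mem_head.
  have /connectP[p] := Tconn a z.
  elim: p a sa => [|b p IHp] a sa /= => [_ za|/andP[ab bp] lp].
    by rewrite za sa in zs.
  case: (boolP (b \in s)) => [sb|sb]; first exact: IHp sb bp lp.
  by exists b, a; rewrite adj_sym.
exists (x :: s); split=> /=; last 1 first.
- have ss a p : {subset a :: p <= s} -> {subset a :: p <= x :: s}.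
    by move=> ps z /ps zs; rewrite inE zs orbT.
  have Lx b : b \in s -> exists p,
      [/\ path adj x p, last x p = b & {subset x :: p <= x :: s}].
    move=> bs; have [p [p1 p2 p3]] := sL y b ys bs.
    exists (y :: p); split=> //=; first by rewrite xy.
    by move=> z; rewrite inE => /orP[/eqP->|/(ss _ _ p3)//]; apply: mem_head.
  have xL b : b \in s -> exists p,
      [/\ path adj b p, last b p = x & {subset b :: p <= x :: s}].
    move=> bs; have [p [p1 p2 p3]] := sL b y bs ys.
    exists (rcons p x); rewrite rcons_path p1 p2 last_rcons adj_sym xy.
    split=> // z; rewrite -rcons_cons mem_rcons inE => /orP[/eqP->|/(ss _ _ p3)//].
    exact: mem_head.
  move=> a b; rewrite !inE => /orP[/eqP->|sa] /orP[/eqP->|sb].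
  + by exists [::]; split=> // z; rewrite mem_seq1 => /eqP->; apply: mem_head.
  + exact: Lx.
  + exact: xL.
  + by have [p [p1 p2 p3]] := sL a b sa sb; exists p; split=> //; apply: ss.
- split=> //; first by right; exists y.
  move=> a b sa sb xa xb; apply/eqP/negPn/negP => /eqP ab.
  (* A second earlier neighbour would close a cycle through [x]. *)
  have [p [p1 p2 p3]] := sL a b sa sb.
  case/shortenP: p1 p2 => p' p'1 p'2 p'3 p'4.
  have p'5 : {subset p' <= s} by move=> z /p'3 zp; apply: p3; rewrite inE zp orbT.
  apply: (Tacyc (x :: a :: p')) => /=.
    by case: (p') p'4 => //= E; case: ab.
  rewrite /ucycle /= xa rcons_path p'1 p'4 adj_sym xb /=.
  rewrite inE negb_or -andbA (p'2 : (a \notin p') && uniq p') andbT; apply/andP; split.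
    by apply: contraNneq xs => ->.
  by apply: contra xs => /p'5.
- by rewrite sz.
Qed.

(** The trace of a build order that the structure theory needs: along edges the
    rank is strict, and a vertex has at most one neighbour of smaller rank, its
    parent. *)
Definition tree_rank (T : sgraph) (rk : T -> nat) : Prop :=
  (forall x y : T, adj x y -> rk x <> rk y) /\
  (forall x y z : T, adj x y -> adj x z -> rk y < rk x -> rk z < rk x -> y = z).

Lemma tree_rankP (T : sgraph) (s : seq T) :
  tree_order s -> (forall x, x \in s) ->
  tree_rank (fun x => size s - index x s).
Proof.
move=> sT sA.
have lt x y : (size s - index y s < size s - index x s) =
              (index x s < index y s).
  have := sA x; have := sA y; rewrite -!index_mem.
  by move: (index x s) (index y s) (size s) => i j l; lia.
split=> [x y xy E|x y z].
  have /(congr1 (nth x s)) : index x s = index y s.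
    have := sA x; have := sA y; rewrite -!index_mem; move: E.
    by move: (index x s) (index y s) (size s) => i j l; lia.
  by rewrite !nth_index // => E'; rewrite E' adj_irrefl in xy.
rewrite !lt; have := sA z; have := sA y; have := sA x.
elim: s sT {sA lt} => //= a s IH [as_ _ au sT].
have ne w : w \in s -> (a == w) = false.
  by move=> ws; apply: contraNF as_ => /eqP->.
rewrite !inE => /orP[/eqP->|xs] /orP[/eqP->|ys] /orP[/eqP->|zs];
  rewrite ?eqxx ?ne // => xy xz; first by move=> _ _; exact: au.
by rewrite !ltnS; apply: IH.
Qed.

Section Subtrees.
Variables (T : sgraph) (rk : T -> nat).

Definition parent (x y : T) : bool := adj x y && (rk y < rk x).

(** For a set [U] of vertices of a tree, being connected means that every vertex
    but the top one [r] has its parent in [U]; this form avoids walks. *)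
Definition subtree (U : {set T}) (r : T) : bool :=
  (r \in U) && [forall w in U, (w != r) ==> [exists y in U, parent w y]].

Definition separated (U U' : {set T}) : bool :=
  [forall x in U, forall y in U', (x != y) && ~~ adj x y].

Lemma subtreeP (U : {set T}) (r : T) :
  reflect (r \in U /\ forall w, w \in U -> w <> r ->
             exists2 y, y \in U & parent w y)
          (subtree U r).
Proof.
apply: (iffP andP) => -[rU].
  move=> /forall_inP rP; split=> // w /rP/implyP wP /eqP /wP /existsP[y].
  by case/andP=> yU wy; exists y.
move=> rP; split=> //; apply/forall_inP=> w wU; apply/implyP => /eqP wr.
by have [y yU wy] := rP w wU wr; apply/existsP; exists y; rewrite yU.
Qed.

Lemma separatedP (U U' : {set T}) :
  reflect (forall x y, x \in U -> y \in U' -> x <> y /\ ~~ adj x y)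
          (separated U U').
Proof.
apply: (iffP idP) => [/forall_inP UP x y /UP/forall_inP xP /xP/andP[/eqP]//|UP].
apply/forall_inP=> x xU; apply/forall_inP=> y yU'.
by case: (UP x y xU yU') => /eqP-> ->.
Qed.

Lemma separated_sym (U U' : {set T}) : separated U U' = separated U' U.
Proof.
by apply/separatedP/separatedP => UP x y xU yU'; case: (UP y x yU' xU);
  rewrite adj_sym => N ->; split=> // E; apply: N.
Qed.

Lemma subtree_rank_min (U : {set T}) r w :
  subtree U r -> w \in U -> rk r <= rk w.
Proof.
move=> /subtreeP[rU rP]; have [n] := ubnP (rk w); elim: n w => // n IH w wn wU.
have [->//|/eqP wr] := eqVneq w r.
have [y yU /andP[_ yw]] := rP w wU wr.
by apply: leq_trans (IH y _ yU) _; lia.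
Qed.

Hypothesis rkT : tree_rank rk.

Lemma parent_inj x y z : parent x y -> parent x z -> y = z.
Proof. by move=> /andP[xy yx] /andP[xz zx]; apply: rkT.2 xy xz yx zx. Qed.

Lemma adj_parent x y : adj x y -> parent x y \/ parent y x.
Proof.
move=> xy; rewrite /parent (adj_sym y x) xy /=.
by have /eqP := rkT.1 _ _ xy; rewrite neq_ltn => /orP[]; [right|left].
Qed.

(** Climbing in parallel inside [U] and [U'] from a common vertex, parents
    coincide, and the climb in [U] stops first because its top ranks at
    least as high. If the two sets are only adjacent, one parent step makes them
    meet, unless the connecting edge is the one above [r]. *)
Lemma subtree_meet (U U' : {set T}) r r' :
  subtree U r -> subtree U' r' -> rk r' <= rk r -> ~~ separated U U' ->
  r \in U' \/ exists2 y, y \in U' & parent r y.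
Proof.
move=> UT U'T rr'; have /subtreeP[rU rP] := UT.
have /subtreeP[rU' rP'] := U'T.
have climb a : a \in U -> a \in U' -> r \in U'.
  have [n] := ubnP (rk a); elim: n a => // n IH a an aU aU'.
  have [<-//|/eqP ar] := eqVneq a r.
  have [y yU ay] := rP a aU ar.
  have ry := subtree_rank_min UT yU.
  have /andP[_ ya] := ay.
  have [E|/eqP ar'] := eqVneq a r'; first by rewrite E in ya; lia.
  have [y' yU' ay'] := rP' a aU' ar'.
  by apply: (IH y) => //; [lia|rewrite (parent_inj ay ay')].
case/forall_inPn => u uU /forall_inPn[w wU'].
rewrite negb_and !negbK => /orP[/eqP uw|uw].
  by left; apply: (climb u) => //; rewrite uw.
have [pu|pw] := adj_parent uw.
  have [E|/eqP ur] := eqVneq u r; first by right; exists w => //; rewrite -E.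
  have [y yU uy] := rP u uU ur.
  by left; apply: (climb w) => //; rewrite (parent_inj pu uy).
have ru := subtree_rank_min UT uU; have /andP[_ ltuw] := pw.
have [E|/eqP wr'] := eqVneq w r'; first by rewrite E in ltuw; lia.
have [y yU' wy] := rP' w wU' wr'.
by left; apply: (climb u) => //; rewrite (parent_inj pw wy).
Qed.

(** A min-max relation for separated subtrees of a tree. Greedily select the
    subtree whose top has the largest rank, together with the edge from that top
    to its parent; by [subtree_meet] this edge touches every member that is not
    separated from the selected one, and one goes on with the others. *)
Lemma subtree_edge_cover (x0 : T) k (C : {set {set T}}) :
  (forall x : T, exists y, adj x y) ->
  (forall U, U \in C -> exists r, subtree U r) ->
  (exists L : seq {set T},
     [/\ size L = k.+1, {subset L <= C} & pairwise separated L]) \/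
  (exists M : seq (T * T),
     [/\ size M = k, forall e, e \in M -> adj e.1 e.2
       & forall U, U \in C -> has (fun e => (e.1 \in U) || (e.2 \in U)) M]).
Proof.
move=> no_isolated; elim: k C => [|k IH] C CT.
  have [->|[U UC]] := set_0Vmem C.
    by right; exists [::]; split=> // U; rewrite inE.
  by left; exists [:: U]; split=> // V; rewrite inE => /eqP->.
have [C0|[U0 U0C]] := set_0Vmem C.
  right; have [y xy] := no_isolated x0.
  exists (nseq k.+1 (x0, y)); split=> [|e|U]; first by rewrite size_nseq.
    by rewrite mem_nseq => /eqP->.
  by rewrite C0 inE.
pose top (U : {set T}) := odflt x0 [pick r | subtree U r].
have topP U : U \in C -> subtree U (top U).
  by move=> /CT[r rU]; rewrite /top; case: pickP => // /(_ r); rewrite rU.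
case: (@arg_maxnP _ U0 (mem C) (fun U => rk (top U)) U0C) => U UC Umax.
(* [y] is the parent of [top U]; at the root of the tree any neighbour will do. *)
have [y [ry yP]] : exists y, adj (top U) y /\
    forall z, parent (top U) z -> z = y.
  case: (pickP (parent (top U))) => [y ry|rN].
    by exists y; split=> [|z rz]; [case/andP: ry|apply: parent_inj rz ry].
  have [y ry] := no_isolated (top U); exists y; split=> // z.
  by rewrite rN.
pose C' := [set V in C | separated U V].
have C'T V : V \in C' -> exists r, subtree V r.
  by rewrite inE => /andP[/CT].
have [[L [sL LC sepL]]|[M [sM Madj MC]]] := IH C' C'T.
  left; exists (U :: L); split; rewrite /= ?sL ?sepL ?andbT //.
    move=> V; rewrite inE => /orP[/eqP->//|/LC].
    by rewrite inE => /andP[].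
  by apply/allP => V /LC; rewrite inE => /andP[].
right; exists ((top U, y) :: M); split; first by rewrite /= sM.
  by move=> e; rewrite inE => /orP[/eqP->|/Madj].
move=> V VC /=; case: (boolP (separated U V)) => [sUV|nsUV].
  by rewrite MC ?orbT // inE VC.
have [->//|[z zV /yP Ez]] := subtree_meet (topP U UC) (topP V VC) (Umax V VC) nsUV.
by rewrite -Ez zV orbT.
Qed.
End Subtrees.

(** * Sunflowers *)

Lemma card_union_bound (I J : finType) (P : pred I) (A : {set J})
    (B : I -> {set J}) n :
  (forall a, a \in A -> exists2 i, P i & a \in B i) ->
  (forall i, P i -> #|B i| <= n) -> #|A| <= #|P| * n.
Proof.
move=> AB Bn; rewrite -sum1_card.
apply: (@leq_trans (\sum_(a in A) \sum_(i | P i) (a \in B i))).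
  apply: leq_sum => a /AB[i Pi ai].
  by rewrite (bigD1 i) //= ai.
rewrite exchange_big /= -sum_nat_const; apply: leq_sum => i /Bn; apply: leq_trans.
rewrite -sum1_card big_mkcond [leqRHS]big_mkcond /=.
by apply: leq_sum => a _; case: (a \in A); case: (a \in B i).
Qed.

(** The Erdos-Rado sunflower lemma for functions, where disjointness is asked
    across different arguments too: the images of the petals are disjoint. The
    core grows from [A]: if there are no [s] members with disjoint images off
    [A], then at most [s * #|T|] points meet all images, so many members share
    one more value, and the induction on the number of free arguments applies. *)
Lemma sunflower (T V : finType) s u (A : {set T}) (G : {set {ffun T -> V}}) :
  0 < s * #|T| -> #|~: A| <= u ->
  (forall f g x, f \in G -> g \in G -> x \in A -> f x = g x) ->
  (s * #|T| * #|T|) ^ u < #|G| ->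
  exists (A' : {set T}) (psi : 'I_s -> {ffun T -> V}),
    [/\ A \subset A', A' != setT, forall i, psi i \in G,
        forall i j x, x \in A' -> psi i x = psi j x
      & forall i j x y, i <> j -> x \notin A' -> y \notin A' ->
          psi i x <> psi j y].
Proof.
move=> sT_gt0; elim: u A G => [|u IH] A G Au GA Gu.
  exfalso; move: Au; rewrite leqn0 cards_eq0 => /eqP A0.
  move: Gu; rewrite expn0 ltnNge => /negP[].
  apply/card_le1_eqP => f g fG gG; apply/ffunP => x.
  by apply: GA => //; rewrite -[A]setCK A0 inE inE.
have G1 : 1 < #|G|.
  apply: leq_ltn_trans Gu; rewrite expn_gt0 muln_gt0 sT_gt0.
  by move: sT_gt0; rewrite muln_gt0 => /andP[_ ->].
have AnT : A != setT.
  apply: contraTneq G1 => AT; rewrite -leqNgt.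
  apply/card_le1_eqP => f g fG gG; apply/ffunP => x.
  by apply: GA => //; rewrite AT inE.
pose disj (f g : {ffun T -> V}) :=
  [forall x in ~: A, forall y in ~: A, f x != g y].
have disjP f g : disj f g -> forall x y, x \notin A -> y \notin A -> f x <> g y.
  move=> /forall_inP fg x y xA yA; apply/eqP.
  have /forall_inP/(_ y) : [forall y in ~: A, f x != g y] by apply: fg; rewrite inE.
  by rewrite inE yA; apply.
(* Either [s] members are disjoint off [A], or a small set meets every member. *)
have [[L [sL LG dL]]|[W [cW WG]]] :
    (exists L : seq {ffun T -> V},
      [/\ size L = s, {subset L <= G} & pairwise disj L]) \/
    (exists W : {set V}, #|W| <= s * #|T| /\
      forall f, f \in G -> exists2 x, x \notin A & f x \in W).
  elim: (s) => [|m [[L [sL LG dL]]|[W [cW WG]]]]; first by left; exists [::].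
    pose W := \bigcup_(f <- L) (f @: ~: A).
    have inW f x : f \in L -> x \notin A -> f x \in W.
      move=> fL xA; rewrite /W big_tnth; apply/bigcupP.
      have /seq_tnthP[i Ei] := fL; exists i => //.
      by rewrite -Ei imset_f // inE.
    have cW : #|W| <= m * #|T|.
      rewrite /W -sL; elim: (L) => [|f L' IHL]; first by rewrite big_nil cards0.
      rewrite big_cons /= mulSn; apply: leq_trans (leq_card_setU _ _) _.
      by apply: leq_add => //; apply: leq_trans (leq_imset_card _ _) (max_card _).
    have [/existsP[f /andP[fG /forall_inP fW]]|/existsPn WG] :=
      boolP [exists f in G, [forall x in ~: A, f x \notin W]].
      left; exists (f :: L); split; first by rewrite /= sL.
        by move=> g; rewrite inE => /orP[/eqP->|/LG].
      rewrite /= dL andbT; apply/allP => g gL; apply/forall_inP => x xA.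
      apply/forall_inP => y yA; apply: contraNneq (fW x xA) => ->.
      by apply: inW => //; rewrite -in_setC.
    right; exists W; split; first by rewrite mulSn; lia.
    move=> f fG; have := WG f; rewrite fG /= => /forall_inPn[x xA].
    by rewrite negbK => fx; exists x => //; rewrite -in_setC.
  by right; exists W; split=> //; rewrite mulSn; lia.
- have [f0 _] : exists f, f \in G by apply/card_gt0P; lia.
  have LnG i : i < s -> nth f0 L i \in G by move=> si; rewrite LG // mem_nth ?sL.
  exists A, (fun i : 'I_s => nth f0 L i); split=> // [i|i j x xA|i j x y ij xA yA].
  + exact: LnG.
  + by apply: GA => //; apply: LnG.
  have /(pairwiseP f0) {}dL := dL.
  have ltP (a b : 'I_s) : a < b -> disj (nth f0 L a) (nth f0 L b).
    by move=> ab; apply: dL => //; rewrite inE sL.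
  have /eqP : i <> j :> nat by move=> /ord_inj.
  rewrite neq_ltn => /orP[/ltP/disjP|/ltP/disjP dji]; first exact.
  by move=> /esym; apply: dji.
have [x xA [w [wW big]]] : exists2 x, x \notin A & exists w, w \in W /\
    (s * #|T| * #|T|) ^ u < #|[set f in G | f x == w]|.
  case: (boolP [exists p : T * V, [&& p.1 \notin A, p.2 \in W &
      (s * #|T| * #|T|) ^ u < #|[set f in G | f p.1 == p.2]| ]]).
    by move=> /existsP[[x w] /= /and3P[xA wW big]]; exists x => //; exists w.
  move=> /existsPn small; suff: #|G| <= (s * #|T| * #|T|) ^ u.+1.
    by rewrite leqNgt Gu.
  have := @card_union_bound _ _ (mem (setX (~: A) W)) G
    (fun p => [set f in G | f p.1 == p.2]) ((s * #|T| * #|T|) ^ u).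
  move/(_ _ _)/leq_trans; apply.
  - move=> f fG; have [x xA fW] := WG f fG.
    by exists (x, f x); rewrite !inE ?xA // fG /=.
  - move=> [x w] /=; rewrite !inE /= => /andP[xA wW].
    by have := small (x, w); rewrite /= xA wW /= -leqNgt.
  rewrite expnS leq_mul2r cardsX; apply/orP; right.
  by rewrite mulnC; apply: leq_mul => //; apply: max_card.
have [||A' [psi [AA' A'T psiG psiA' psiD]]] := IH (x |: A) _ _ _ big.
- have := cardsC A; have := cardsC (x |: A); rewrite cardsU1 xA /=; lia.
- move=> f g y; rewrite !inE => /andP[fG /eqP fx] /andP[gG /eqP gx].
  by case/orP=> [/eqP->|yA]; [rewrite fx gx|apply: GA].
exists A', psi; split=> //; first exact: subset_trans (subsetUr _ _) AA'.
by move=> i; have := psiG i; rewrite inE => /andP[].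
Qed.

(** * Blowable subtrees bound the number of copies *)

(** [U] can be moved in [s] disjoint ways while the rest of the copy [phi] stays in
    place: the copy sits in a blow-up of [T] along [U]. *)
Definition blowable (T G : sgraph) s (phi : {ffun T -> G}) (U : {set T}) : Prop :=
  exists psi : 'I_s -> {ffun T -> G},
    [/\ forall i, psi i \in embeddings T G,
        forall i x, x \notin U -> psi i x = phi x
      & forall i j x y, i <> j -> x \in U -> y \in U -> psi i x <> psi j y].

(** The component of a vertex of minimal rank: it consists of the vertices whose
    climb to that vertex stays in [X]. *)
Lemma component_subtree (T : sgraph) (rk : T -> nat) (X : {set T}) :
  tree_rank rk -> X != set0 ->
  exists (U : {set T}) (r : T),
    [/\ subtree rk U r, U \subset X
      & forall x y, x \in U -> y \in X -> adj x y -> y \in U].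
Proof.
move=> rkT /set0Pn[x0 x0X].
case: (@arg_minnP _ x0 (mem X) rk x0X) => r rX rmin.
pose e := [rel x y | [&& parent rk x y, x \in X & y \in X]].
pose U := [set w in X | connect e w r].
have step w : w \in U -> w <> r -> exists2 y, y \in U & parent rk w y.
  rewrite inE => /andP[wX /connectP[[|y p] /=]]; first by move=> _ ->.
  case/andP=> /and3P[wy _ yX] yp lp _; exists y => //.
  by rewrite inE yX; apply/connectP; exists p.
exists U, r; split.
- by apply/subtreeP; split=> //; rewrite inE [r \in X]rX connect0.
- by apply/subsetP => x; rewrite inE => /andP[].
move=> x y xU yX xy; have xX : x \in X by move: xU; rewrite inE => /andP[].
have [pxy|pyx] := adj_parent rkT xy; last first.
  move: xU; rewrite !inE yX => /andP[_ xr] /=.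
  by apply: connect_trans xr; apply: connect1; rewrite /= pyx yX xX.
have [E|/eqP xr] := eqVneq x r.
  by have := rmin y yX; have /andP[_] := pxy; rewrite E; lia.
by have [z zU pxz] := step x xU xr; rewrite (parent_inj rkT pxy pxz).
Qed.

(** Many copies of [T] that agree on [S] contain a sunflower, whose core contains
    [S]. One component of the complement of the core can then be moved by itself:
    its neighbours outside lie in the core, where all petals agree. *)
Lemma blowable_subtree_avoiding (T G : sgraph) (rk : T -> nat) s (S : {set T})
    (Phi : {set {ffun T -> G}}) :
  tree_rank rk -> 0 < s -> 0 < #|T| -> Phi \subset embeddings T G ->
  (forall f g x, f \in Phi -> g \in Phi -> x \in S -> f x = g x) ->
  (s * #|T| * #|T|) ^ #|T| < #|Phi| ->
  exists (phi : {ffun T -> G}) (U : {set T}) (r : T),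
    [/\ phi \in Phi, subtree rk U r, blowable s phi U
      & forall x, x \in S -> x \notin U].
Proof.
move=> rkT s0 T0 /subsetP PhiE PhiS big.
have sT0 : 0 < s * #|T| by rewrite muln_gt0 s0.
have [A [psi [SA AT psiP psiA psiD]]] :=
  sunflower sT0 (max_card (mem (~: S))) PhiS big.
have A'0 : ~: A != set0 by apply: contra AT; rewrite -setCT => /eqP/setC_inj->.
have [U [r [UT /subsetP UA Uc]]] := component_subtree rkT A'0.
have UnA x : x \in U -> x \notin A by move=> /UA; rewrite inE.
pose i0 := Ordinal s0.
have psiE i := PhiE _ (psiP i).
exists (psi i0), U, r; split=> //; last first.
  by move=> x xS; apply/negP => /UnA; rewrite (subsetP SA).
exists (fun i => [ffun x => if x \in U then psi i x else psi i0 x]); split.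
- move=> i; have /embeddingsP[iI iA] := psiE i.
  have /embeddingsP[oI oA] := psiE i0.
  have mix x y : x \in U -> y \notin U -> psi i x = psi i0 y -> x = y.
    move=> xU yU; case: (boolP (y \in A)) => [yA|yA].
      by rewrite (psiA i0 i) // => /iI.
    have [->|/eqP ii0] := eqVneq i i0; first by move/oI.
    by move/(psiD _ _ _ _ ii0 (UnA x xU) yA).
  have mixA x y : x \in U -> y \notin U -> adj x y -> adj (psi i x) (psi i0 y).
    move=> xU yU xy; rewrite (psiA i0 i) ?iA //.
    by apply: contraNT yU => yA; apply: (Uc x) => //; rewrite inE.
  apply/embeddingsP; split=> x y; rewrite !ffunE;
    case: (boolP (x \in U)) => xU; case: (boolP (y \in U)) => yU.
  + exact: iI.
  + exact: mix.
  + by move=> /esym/mix->.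
  + exact: oI.
  + exact: iA.
  + exact: mixA.
  + by rewrite adj_sym => /mixA xy; rewrite adj_sym xy.
  + exact: oA.
- by move=> i x xU; rewrite ffunE (negPf xU).
- by move=> i j x y ij xU yU; rewrite !ffunE xU yU; apply: psiD => //; apply: UnA.
Qed.

Definition adj_pairs (G : sgraph) : {set G * G} := [set e | adj e.1 e.2].

(** Without [k.+1] separated blowable subtrees, the blowable subtrees of a copy are
    all touched by [k] edges of [T]. The images of these edges determine the copy
    up to a bounded number of choices, because a blowable subtree avoiding their
    endpoints would appear otherwise; and each edge goes to an edge of [G]. *)
Lemma card_embeddings_bound (T G : sgraph) (rk : T -> nat) (x0 : T) s k :
  tree_rank rk -> 0 < s -> (forall x : T, exists y, adj x y) ->
  (forall phi, phi \in embeddings T G -> forall L : seq {set T},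
     size L = k.+1 -> pairwise (@separated T) L ->
     ~ (forall U, U \in L -> (exists r, subtree rk U r) /\ blowable s phi U)) ->
  #|embeddings T G| <=
    (#|T| * #|T|) ^ k * ((s * #|T| * #|T|) ^ #|T| * #|adj_pairs G| ^ k).
Proof.
move=> rkT s0 nbr noL.
have T0 : 0 < #|T| by apply/card_gt0P; exists x0.
pose touches (U : {set T}) (e : T * T) := (e.1 \in U) || (e.2 \in U).
pose covers (phi : {ffun T -> G}) (M : k.-tuple (T * T)) :=
  `[< forall U, (exists r, subtree rk U r) -> blowable s phi U ->
      has (touches U) M >].
have := @card_union_bound _ _
  [pred M : k.-tuple (T * T) | all (fun e => adj e.1 e.2) M] (embeddings T G)
  (fun M => [set phi in embeddings T G | covers phi M])
  ((s * #|T| * #|T|) ^ #|T| * #|adj_pairs G| ^ k).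
move/(_ _ _)/leq_trans; apply; last first.
- by rewrite -card_prod -card_tuple leq_mul2r max_card orbT.
- move=> M Madj.
  pose trace (phi : {ffun T -> G}) :=
    [ffun i : 'I_k => (phi (tnth M i).1, phi (tnth M i).2)].
  have := @card_union_bound _ _
    [pred g in ffun_on (mem (adj_pairs G))]
    [set phi in embeddings T G | covers phi M]
    (fun g => [set phi in embeddings T G | covers phi M && (trace phi == g)])
    ((s * #|T| * #|T|) ^ #|T|).
  move/(_ _ _)/leq_trans; apply; last first.
  + by rewrite mulnC leq_mul2l card_ffun_on card_ord leqnn orbT.
  + move=> g _; rewrite leqNgt; apply/negP => big.
    pose S := [set x | has (fun e => (e.1 == x) || (e.2 == x)) M].
    have [||phi [U [r [phiP UT Ub US]]]] :=
      blowable_subtree_avoiding (S := S) rkT s0 T0 _ _ big.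
    * by apply/subsetP => phi; rewrite inE => /andP[].
    * move=> f f' x; rewrite !inE => /and3P[_ _ /eqP fg] /and3P[_ _ /eqP f'g].
      move=> /hasP[e /tnthP[i ->]]; move: f'g; rewrite -fg => /ffunP/(_ i).
      by rewrite !ffunE => -[E1 E2] /orP[]/eqP<-.
    move: phiP; rewrite inE => /and3P[_ /asboolP phiM _].
    have /hasP[e eM eU] := phiM U (ex_intro _ r UT) Ub.
    have inS : (e.1 \in S) && (e.2 \in S).
      by rewrite !inE; apply/andP; split; apply/hasP; exists e; rewrite ?eqxx ?orbT.
    by case/andP: inS => /US/negPf e1 /US/negPf e2; rewrite /touches e1 e2 in eU.
  move=> phi; rewrite inE => /andP[phiE phiM]; exists (trace phi); last first.
    by rewrite inE phiE phiM eqxx.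
  apply/ffun_onP => i; rewrite ffunE inE /=.
  have /embeddingsP[_ phiA] := phiE.
  by apply: phiA; apply: (allP Madj); apply: mem_tnth.
move=> phi phiE.
pose C := [set U | `[< (exists r, subtree rk U r) /\ blowable s phi U >]].
have inC U : U \in C -> (exists r, subtree rk U r) /\ blowable s phi U.
  by rewrite inE => /asboolP.
have CT U : U \in C -> exists r, subtree rk U r by case/inC.
have [[L [sL LC sepL]]|[M [sM Madj MC]]] := subtree_edge_cover rkT x0 k nbr CT.
  by case: (noL phi phiE L sL sepL) => U /LC/inC.
have sM' : size M == k by apply/eqP.
exists (Tuple sM'); first by apply/allP.
rewrite inE phiE /=; apply/asboolP => U UT Ub; apply: MC.
by rewrite inE; apply/asboolP.
Qed.

(** * Blow-ups of a tree *)

Section Blowup.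
Variables (I : finType) (T : sgraph) (c : {ffun T -> option I}) (t : nat).

(** The set blown up consists of the [x] with [c x] different from [None], and
    [c x] names the part of [x]; vertices outside are kept in level 0 only. Adjacent
    vertices of a part are joined level by level. *)
Definition blowup_vertex : finType :=
  {p : T * 'I_t.+1 | (c p.1 != None) || (p.2 == ord0)}.

Definition blowup_adj : rel blowup_vertex := fun u v =>
  adj (val u).1 (val v).1 &&
  [|| c (val u).1 == None, c (val v).1 == None | (val u).2 == (val v).2].

Lemma blowup_adj_sym : symmetric blowup_adj.
Proof.
by move=> u v; rewrite /blowup_adj adj_sym orbCA [_.2 == _]eq_sym.
Qed.

Lemma blowup_adj_irrefl : irreflexive blowup_adj.
Proof. by move=> u; rewrite /blowup_adj adj_irrefl. Qed.

Definition blowup : sgraph := SGraph blowup_adj_sym blowup_adj_irrefl.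

Lemma leq_card_blowup : #|blowup| <= #|T| * t.+1.
Proof.
by rewrite card_sig; apply: leq_trans (max_card _) _; rewrite card_prod card_ord.
Qed.

Lemma ltn_card_blowup i x : c x = Some i -> t < #|blowup|.
Proof.
move=> cx.
have vP (a : 'I_t.+1) : (c (x, a).1 != None) || ((x, a).2 == ord0) by rewrite /= cx.
have := @leq_card 'I_t.+1 blowup (fun a => exist _ (x, a) (vP a)).
by rewrite card_ord; apply=> a b /(congr1 val)[].
Qed.

(** A choice of one copy of each part gives a copy of [T], and different choices
    give copies with different vertex sets. *)
Lemma copies_blowup :
  (forall i, exists x, c x = Some i) ->
  (forall x y i j, adj x y -> c x = Some i -> c y = Some j -> i = j) ->
  forall (G : sgraph) (f : blowup -> G), injective f ->
    (forall u v, adj u v -> adj (f u) (f v)) ->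
    t.+1 ^ #|I| <= #|copies T G|.
Proof.
move=> c_onto c_comp G f fI fA.
pose lev (g : {ffun I -> 'I_t.+1}) x := if c x is Some i then g i else ord0.
have levP g x : (c (x, lev g x).1 != None) || ((x, lev g x).2 == ord0).
  by rewrite /lev /=; case: (c x).
pose b g x : blowup := exist _ (x, lev g x) (levP g x).
have bI g g' x y : b g x = b g' y -> x = y /\ lev g x = lev g' y.
  by move=> /(congr1 val)[-> ->].
rewrite -[t.+1]card_ord -card_ffun.
apply: (@leq_card_copies _ T G (fun g => [ffun x => f (b g x)])).
  move=> g; apply/embeddingsP; split=> x y; rewrite !ffunE.
    by move=> /fI/bI[].
  move=> xy; apply: fA; rewrite /= /blowup_adj /= xy /= /lev.
  case cx: (c x) => [i|] //=; case cy: (c y) => [j|] //=.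
  by rewrite (c_comp x y i j) ?eqxx.
move=> g g' /setP gg'; apply/ffunP => i; have [x cx] := c_onto i.
have := gg' (f (b g x)).
have -> : f (b g x) \in [ffun x => f (b g x)] @: [set: T].
  by apply/imsetP; exists x; rewrite ?ffunE.
move=> /esym/imsetP[y _]; rewrite ffunE => /fI/bI[<-].
by rewrite /lev cx.
Qed.
End Blowup.

(** Greedy choice: the at most [#|Q| * h] points used by the other indices can spoil
    at most one candidate each. *)
Lemma disjoint_choice (Q V : finType) s h (X : Q -> 'I_s -> {set V}) :
  (forall q i, #|X q i| <= h) ->
  (forall q i j v, i <> j -> v \in X q i -> v \notin X q j) ->
  #|Q| * h < s ->
  exists j : Q -> 'I_s,
    forall q q' v, q <> q' -> v \in X q (j q) -> v \notin X q' (j q').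
Proof.
move=> Xh Xd Qs.
suff H (l : seq Q) : size l * h < s ->
    exists j : Q -> 'I_s, forall q q' v, q \in l -> q' \in l -> q <> q' ->
      v \in X q (j q) -> v \notin X q' (j q').
  have [|j jP] := H (enum Q); first by rewrite -cardE.
  by exists j => q q' v; apply: jP; rewrite mem_enum.
elim: l => [|q l IH] ls.
  by exists (fun _ => Ordinal (leq_ltn_trans (leq0n _) ls)).
have [|j jP] := IH; first by apply: leq_ltn_trans ls; rewrite /= mulSn leq_addl.
pose W := \bigcup_(q' in l) X q' (j q').
have cW : #|W| <= size l * h.
  have := @card_union_bound _ _ (mem l) W (fun q' => X q' (j q')) h.
  move/(_ _ _)/leq_trans; apply.
  - by move=> v /bigcupP[q' ql v1]; exists q'.
  - by [].
  by rewrite leq_mul2r card_size orbT.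
have [i iW] : exists i, forall v, v \in X q i -> v \notin W.
  have : [exists i, [forall v in X q i, v \notin W]].
    apply: contraTT ls; rewrite negb_exists -leqNgt => /forallP hit.
    rewrite /= mulSn -{1}[s]card_ord.
    have := @card_union_bound _ _ (mem W) [set: 'I_s]
      (fun v => [set i | v \in X q i]) 1.
    rewrite cardsT muln1 => /(_ _ _)/leq_trans; apply; last exact: leq_trans cW (leq_addl _ _).
      move=> i _; have /forall_inPn[v vX] := hit i; rewrite negbK => vW.
      by exists v; rewrite // inE.
    move=> v _; apply/card_le1_eqP => a b; rewrite !inE => va vb.
    apply/eqP/negPn/negP => /eqP ab.
    by have := Xd q _ _ v ab; rewrite va vb => /(_ isT).
  by move=> /existsP[i /forall_inP iP]; exists i.
exists (fun q0 => if q0 == q then i else j q0) => q1 q2 v.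
have inW q' u : q' \in l -> u \in X q' (j q') -> u \in W.
  by move=> ql uX; apply/bigcupP; exists q'.
rewrite !inE; have [->|nq1] := eqVneq q1 q; have [->|nq2] := eqVneq q2 q => //=.
- by move=> _ q2l _ /iW; apply: contra; apply: inW.
- by move=> q1l _ _ vX; apply/negP => /iW; rewrite (inW q1).
- exact: jP.
Qed.

(** Each part comes with many disjoint ways to move it; choosing [t.+1] of them for
    every part so that all the moved parts are disjoint yields the whole
    blow-up, as there are no edges between different parts. *)
Lemma blowup_embedding (I : finType) (T G : sgraph) (phi : {ffun T -> G})
    (L : I -> {set T}) s t :
  phi \in embeddings T G -> (forall i, blowable s phi (L i)) ->
  (forall i j, i <> j -> separated (L i) (L j)) ->
  #|I| * t.+1 * #|T| < s ->
  exists f : blowup [ffun x => [pick i | x \in L i]] t -> G,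
    injective f /\ forall u v, adj u v -> adj (f u) (f v).
Proof.
move=> phiE Lb Lsep big; set c := [ffun x => _].
have cP x i : c x = Some i -> x \in L i.
  by rewrite ffunE; case: pickP => // j xj [<-].
have cN x i : c x = None -> x \notin L i.
  by rewrite ffunE; case: pickP => // /(_ i)->.
have [phiI phiA] := embeddingsP phi phiE.
have [psi psiP] := choice Lb.
have psiE i j := let: And3 p _ _ := psiP i in embeddingsP _ (p j).
have psiphi i := let: And3 _ p _ := psiP i in p.
have psiD i := let: And3 _ _ p := psiP i in p.
pose X (q : I * 'I_t.+1) j := psi q.1 j @: L q.1.
have [|||ch chP] := @disjoint_choice _ _ s #|T| X.
- by move=> q i; apply: leq_trans (leq_imset_card _ _) (max_card _).
- move=> q i j v ij /imsetP[x xL ->]; apply/negP => /imsetP[y yL].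
  exact: psiD.
- by rewrite card_prod card_ord.
pose f (u : blowup c t) : G :=
  if c (val u).1 is Some i then psi i (ch (i, (val u).2)) (val u).1
  else phi (val u).1.
have fX (u : blowup c t) i : c (val u).1 = Some i ->
    f u \in X (i, (val u).2) (ch (i, (val u).2)).
  by move=> cu; rewrite /f cu; apply: imset_f; apply: cP.
have pair_ext (p q : T * 'I_t.+1) : p.1 = q.1 -> p.2 = q.2 -> p = q.
  by case: p q => [? ?] [? ?] /= -> ->.
exists f; split.
- move=> u v E; apply: val_inj.
  case cu: (c (val u).1) => [i|]; case cv: (c (val v).1) => [j|].
  + have [Eq|/eqP Nq] := eqVneq (i, (val u).2) (j, (val v).2).
      move: E; rewrite /f cu cv; case: Eq => <- E2; rewrite -E2.
      move/(psiE i _).1 => E1.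
      exact: pair_ext.
    by have := chP _ _ _ Nq (fX u i cu); rewrite E fX.
  + move: E; rewrite /f cu cv -(psiphi i (ch (i, (val u).2))) ?cN //.
    by move/(psiE i _).1 => E1; rewrite E1 cv in cu.
  + move: E; rewrite /f cu cv -(psiphi j (ch (j, (val v).2))) ?cN //.
    by move/(psiE j _).1 => E1; rewrite -E1 cu in cv.
  + move: E; rewrite /f cu cv => /phiI E1.
    have := valP u; have := valP v; rewrite cu cv /= => /eqP v0 /eqP u0.
    by apply: pair_ext => //; rewrite u0 v0.
have half u v i : c (val u).1 = Some i -> c (val v).1 = None ->
    adj (val u).1 (val v).1 -> adj (f u) (f v).
  move=> cu cv uv; rewrite /f cu cv -(psiphi i (ch (i, (val u).2))) ?cN //.
  exact: (psiE i _).2.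
move=> u v /andP[uv].
case cu: (c (val u).1) => [i|]; case cv: (c (val v).1) => [j|] /=.
- have [Eij|/eqP Nij] := eqVneq i j.
    move=> /eqP E2; rewrite /f cu cv -Eij E2; exact: (psiE i _).2.
  have /separatedP/(_ _ _ (cP _ _ cu) (cP _ _ cv))[_] := Lsep i j Nij.
  by rewrite uv.
- by move=> _; apply: half cu cv uv.
- by move=> _; rewrite adj_sym; apply: half cv cu _; rewrite adj_sym.
- by move=> _; rewrite /f cu cv; apply: phiA.
Qed.

(** * Copies in free graphs, in terms of the number of edges *)

(** Transport of [G] to the vertex set over which [extremal] ranges. *)
Lemma edge_graph_enum (G : sgraph) :
  exists E : {set {set 'I_#|G|}},
    forall x y : 'I_#|G|,
      edge_adj E x y = adj (enum_val x : G) (enum_val y).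
Proof.
exists [set e | [exists x : 'I_#|G|, exists y : 'I_#|G|,
  adj (enum_val x : G) (enum_val y) && (e == [set x; y])]] => x y.
rewrite /edge_adj inE; apply/andP/idP => [[_ /existsP[u /existsP[v]]]|xy].
  by case/andP=> uv /eqP/eq_set2[][-> ->] //; rewrite adj_sym.
split; first by apply: contraTneq xy => ->; rewrite adj_irrefl.
by apply/existsP; exists x; apply/existsP; exists y; rewrite xy /=.
Qed.

Lemma leq_copies_extremal (n : nat) (H : sgraph) (F : sgraph -> Prop)
    (E : {set {set 'I_n}}) :
  is_free F (edge_graph E) -> #|copies H (edge_graph E)| <= extremal n H F.
Proof.
move=> EF; apply: (@leq_bigmax_cond _ _ (fun E => #|copies H (edge_graph E)|)).
exact/asboolP.
Qed.

(** If every blow-up embedded in a free graph, then the blow-ups would be free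
    themselves; having [O(t)] vertices and at least [t.+1 ^ #|I|] copies of [T],
    they would contradict the assumed growth of [extremal]. *)
Lemma forbidden_blowup (T : sgraph) (F : sgraph -> Prop) (I : finType)
    (c : {ffun T -> option I}) :
  (forall K, exists N, forall n, N <= n -> K * extremal n T F <= n ^ #|I|) ->
  0 < #|I| -> (forall i, exists x, c x = Some i) ->
  (forall x y i j, adj x y -> c x = Some i -> c y = Some j -> i = j) ->
  exists t, forall G : sgraph, is_free F G ->
    ~ exists f : blowup c t -> G,
        injective f /\ forall u v, adj u v -> adj (f u) (f v).
Proof.
move=> small /card_gt0P[i0 _] c_onto c_comp; apply: contrapT => /forallNP none.
have [N HN] := small (#|T| ^ #|I|).+1.
have /existsNP[G /not_implyP[GF /contrapT[f [fI fA]]]] := none N.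
have BF := is_free_embedding fI fA GF.
set B := blowup c N in f fI fA BF.
have [E EB] := edge_graph_enum B.
have EF : is_free F (edge_graph E).
  apply: (@is_free_embedding F (edge_graph E) B enum_val) BF.
    exact: enum_val_inj.
  by move=> x y; rewrite /= EB.
have := @copies_blowup _ _ c N c_onto c_comp (edge_graph E) enum_rank.
move=> /(_ enum_rank_inj) many.
have {}many : N.+1 ^ #|I| <= extremal #|B| T F.
  apply: leq_trans _ (leq_copies_extremal T EF); apply: many => u v uv.
  by rewrite /= EB !enum_rankK.
have [x0 cx0] := c_onto i0.
have := HN #|B| (ltnW (ltn_card_blowup N cx0)).
have := leq_card_blowup c N; rewrite -(leq_exp2r _ _ (e := #|I|)); last first.
  by apply/card_gt0P; exists i0.
rewrite expnMn => le1 le2; have := leq_trans le2 le1.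
rewrite leqNgt mulSn => /negP[].
have : 0 < N.+1 ^ #|I| by rewrite expn_gt0.
have := leq_mul (leqnn (#|T| ^ #|I|)) many.
lia.
Qed.

(** In a free graph no copy of [T] has [k.+1] separated subtrees that are blowable
    for large [s], since they would give a forbidden blow-up. There are finitely
    many ways to place the parts in [T], so one [s] suffices for all of them. *)
Lemma card_embeddings_free (T : sgraph) (rk : T -> nat) (x0 : T)
    (F : sgraph -> Prop) k :
  tree_rank rk ->
  (forall x : T, exists y, adj x y) ->
  (forall K, exists N, forall n, N <= n -> K * extremal n T F <= n ^ k.+1) ->
  exists K, forall G : sgraph, is_free F G ->
    #|embeddings T G| <= K * #|adj_pairs G| ^ k.
Proof.
move=> rkT nbr small.
pose good (c : {ffun T -> option 'I_k.+1}) :=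
  (forall i, exists x, c x = Some i) /\
  (forall x y i j, adj x y -> c x = Some i -> c y = Some j -> i = j).
have /choice[t tP] : forall c, exists t, good c -> forall G, is_free F G ->
    ~ exists f : blowup c t -> G,
        injective f /\ forall u v, adj u v -> adj (f u) (f v).
  move=> c; have [[c1 c2]|bad] := pselect (good c); last by exists 0.
  have [||t tP] := @forbidden_blowup T F _ c _ _ c1 c2; rewrite ?card_ord //.
  by exists t.
pose s := (k.+1 * (\max_c t c).+1 * #|T|).+1.
exists ((#|T| * #|T|) ^ k * (s * #|T| * #|T|) ^ #|T|) => G GF.
rewrite -mulnA; apply: (card_embeddings_bound x0 rkT) => //.
move=> phi phiE L sL sepL LP.
pose Li (i : 'I_k.+1) := nth set0 L i.
have LiL i : Li i \in L by rewrite mem_nth ?sL.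
have Lisep i j : i <> j -> separated (Li i) (Li j).
  have /(pairwiseP set0) lt := sepL.
  have {}lt (a b : 'I_k.+1) : a < b -> separated (Li a) (Li b).
    by apply: lt; rewrite inE sL.
  move=> ij; have /eqP : i <> j :> nat by move=> /ord_inj.
  by rewrite neq_ltn => /orP[/lt|/lt] //; rewrite separated_sym.
pose c := [ffun x => [pick i | x \in Li i]].
have cP x i : c x = Some i -> x \in Li i.
  by rewrite ffunE; case: pickP => // j xj [<-].
have c_good : good c.
  split=> [i|x y i j xy cx cy].
    have [[r /andP[rL _]] _] := LP _ (LiL i); exists r.
    rewrite ffunE; case: pickP => [j rj|/(_ i)]; last by rewrite rL.
    congr Some; apply: contrapT => /Lisep/separatedP/(_ r r rj rL)[] //.
  apply: contrapT => /Lisep/separatedP/(_ x y (cP _ _ cx) (cP _ _ cy))[_].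
  by rewrite xy.
apply: (tP c c_good G GF); apply: (blowup_embedding (s := s) phiE) => //.
  by move=> i; case: (LP _ (LiL i)).
rewrite card_ord ltnS leq_mul2r leq_mul2l ltnS.
by rewrite (leq_bigmax c) !orbT.
Qed.

(** * Greedy embedding of a tree and vertex deletion *)

Definition degree (G : sgraph) (v : G) : nat := #|[set w | adj v w]|.

Section GreedyEmbedding.
Variables (T G : sgraph) (v0 : G) (D : nat).
Hypothesis degD : forall v : G, D + #|T| <= degree v.

(** Outside of [s] the values are set to [v0], so that these functions count
    the embeddings of the subgraph of [T] induced on [s]. *)
Definition partial_embedding (s : seq T) (f : {ffun T -> G}) : bool :=
  [&& [forall x in s, forall y in s, (f x == f y) ==> (x == y)],
      [forall x in s, forall y in s, adj x y ==> adj (f x) (f y)]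
    & [forall x, (x \notin s) ==> (f x == v0)]].

Lemma partial_embeddingP (s : seq T) (f : {ffun T -> G}) :
  reflect [/\ {in s &, injective f},
              {in s &, forall x y, adj x y -> adj (f x) (f y)}
            & forall x, x \notin s -> f x = v0]
          (partial_embedding s f).
Proof.
apply: (iffP and3P) => -[f1 f2 f3]; split.
- move=> x y xs ys E; have /forall_inP/(_ y ys)/implyP := forall_inP f1 x xs.
  by rewrite E eqxx => /(_ isT)/eqP.
- move=> x y xs ys; have /forall_inP/(_ y ys)/implyP := forall_inP f2 x xs.
  exact.
- by move=> x xs; have /implyP/(_ xs)/eqP := forallP f3 x.
- apply/forall_inP => x xs; apply/forall_inP => y ys.
  by apply/implyP => /eqP/f1 ->.
- apply/forall_inP => x xs; apply/forall_inP => y ys.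
  by apply/implyP; apply: f2.
- by apply/forallP => x; apply/implyP => /f3->.
Qed.

(** Each new vertex of [T] is attached to the image of its only earlier neighbour,
    which has at least [D] neighbours outside of the image so far. *)
Lemma leq_card_partial_embedding (s : seq T) :
  tree_order s -> 0 < size s ->
  #|G| * D ^ (size s).-1 <= #|[set f | partial_embedding s f]|.
Proof.
elim: s => //= x s IH [xs nbr uniq_nbr sT] _.
pose ext (f : {ffun T -> G}) w : {ffun T -> G} := [ffun z => if z == x then w else f z].
have extx f w : ext f w x = w by rewrite ffunE eqxx.
have exts f w z : z \in s -> ext f w z = f z.
  by move=> zs; rewrite ffunE; case: eqP => // E; rewrite -E zs in xs.
have [s0|[y ys xy]] := nbr.
  rewrite s0 muln1.
  have /card_imset <- : injective (ext [ffun => v0]).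
    by move=> a b /ffunP/(_ x); rewrite !extx.
  rewrite subset_leq_card //; apply/subsetP => _ /imsetP[w _ ->].
  rewrite inE; apply/partial_embeddingP; split=> [a b|a b|a].
  - by rewrite !mem_seq1 => /eqP-> /eqP->.
  - by rewrite !mem_seq1 => /eqP-> /eqP->; rewrite adj_irrefl.
  - by rewrite mem_seq1 !ffunE => /negPf->.
have s0 : 0 < size s by case: (s) ys.
rewrite -(prednK s0) expnS mulnCA.
pose B (f : {ffun T -> G}) := [set w | adj (f y) w] :\: f @: [set z in s].
have BD f : D <= #|B f|.
  have := degD (f y); rewrite /degree -(cardsID (f @: [set z in s])).
  set S := f @: _ => le_deg.
  have ST : #|S| <= #|T| := leq_trans (leq_imset_card _ _) (max_card _).
  have := leq_trans (subset_leq_card (subsetIr [set w | adj (f y) w] S)) ST.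
  by rewrite /B -/S; lia.
pose X := [set p : {ffun T -> G} * G | partial_embedding s p.1 & p.2 \in B p.1].
apply: (@leq_trans #|X|).
  have -> : #|X| = \sum_(f | partial_embedding s f) #|B f|.
    under eq_bigr do rewrite -sum1_card.
    by rewrite pair_big_dep -sum1_card; apply: eq_bigl => p; rewrite inE.
  apply: leq_trans (leq_mul (leqnn D) (IH sT s0)) _.
  rewrite mulnC -sum_nat_const (eq_bigl _ _ (in_set _)).
  by apply: leq_sum => f _; apply: BD.
rewrite -(card_in_imset (f := fun p => ext p.1 p.2)); last first.
  move=> [f w] [g u]; rewrite !inE /= => /andP[/partial_embeddingP[_ _ f0] _].
  move=> /andP[/partial_embeddingP[_ _ g0] _] E; congr pair.
    apply/ffunP => z; have /ffunP/(_ z) := E; rewrite !ffunE.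
    by case: eqP => // -> _; rewrite f0 // g0.
  by have /ffunP/(_ x) := E; rewrite !extx.
rewrite subset_leq_card //; apply/subsetP => _ /imsetP[[f w] /= fw ->].
move: fw; rewrite !inE /= => /andP[/partial_embeddingP[f1 f2 f3] /andP[wN fyw]].
have wf z : z \in s -> f z <> w.
  by move=> zs E; case/negP: wN; apply/imsetP; exists z; rewrite ?inE.
apply/partial_embeddingP; split=> [a b|a b|a].
- rewrite !inE => /orP[/eqP->|as_] /orP[/eqP->|bs] //; rewrite ?extx ?exts //.
  + by move=> /esym/(wf b bs).
  + by move=> /(wf a as_).
  + exact: f1.
- rewrite !inE => /orP[/eqP->|as_] /orP[/eqP->|bs]; rewrite ?extx ?exts //.
  + by rewrite adj_irrefl.
  + by move=> xb; rewrite adj_sym (uniq_nbr b y).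
  + by rewrite adj_sym => xa; rewrite (uniq_nbr a y).
  + exact: f2.
- rewrite inE negb_or ffunE => /andP[/negPf-> /f3]; exact.
Qed.
End GreedyEmbedding.

Lemma leq_card_embeddings (T G : sgraph) (s : seq T) D :
  tree_order s -> (forall x, x \in s) -> 0 < #|T| ->
  (forall v : G, D + #|T| <= degree v) ->
  #|G| * D ^ #|T|.-1 <= #|embeddings T G|.
Proof.
move=> sT sA T0 degD; have [->//|] := posnP #|G|.
move=> /card_gt0P[v0 _].
have sz : size s = #|T|.
  rewrite -(card_uniqP (tree_order_uniq sT)).
  by apply: eq_card => x; rewrite sA.
rewrite -sz; apply: leq_trans (leq_card_partial_embedding v0 degD sT _) _.
  by rewrite sz.
rewrite subset_leq_card //; apply/subsetP => f.
rewrite inE => /partial_embeddingP[f1 f2 _].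
by apply/embeddingsP; split=> [x y|x y]; [apply: f1|apply: f2].
Qed.

Section DeleteVertex.
Variables (G : sgraph) (v : G).

Definition delete_adj : rel {x : G | x != v} := fun x y => adj (val x) (val y).

Lemma delete_adj_sym : symmetric delete_adj.
Proof. by move=> x y; rewrite /delete_adj adj_sym. Qed.

Lemma delete_adj_irrefl : irreflexive delete_adj.
Proof. by move=> x; rewrite /delete_adj adj_irrefl. Qed.

Definition delete_vertex : sgraph := SGraph delete_adj_sym delete_adj_irrefl.

Lemma card_delete_vertex : #|delete_vertex| = #|G|.-1.
Proof. by rewrite card_sig cardC1. Qed.

Lemma adj_pairs_delete_vertex :
  #|adj_pairs G| <= #|adj_pairs delete_vertex| + 2 * degree v.
Proof.
pose up (e : delete_vertex * delete_vertex) := (val e.1, val e.2).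
have sub : adj_pairs G \subset up @: adj_pairs delete_vertex :|:
    ([set (v, w) | w in [set w | adj v w]] :|:
     [set (w, v) | w in [set w | adj v w]]).
  apply/subsetP => -[x y]; rewrite inE /= => xy; rewrite !inE.
  have [Ex|xv] := eqVneq x v.
    apply/orP; right; apply/orP; left; apply/imsetP; exists y; rewrite ?inE -?Ex //.
  have [Ey|yv] := eqVneq y v.
    apply/orP; right; apply/orP; right; apply/imsetP; exists x; rewrite ?inE -?Ey //.
    by rewrite adj_sym.
  apply/orP; left; apply/imsetP.
  by exists (exist _ x xv, exist _ y yv); rewrite ?inE.
apply: leq_trans (subset_leq_card sub) _; rewrite mul2n -addnn.
apply: leq_trans (leq_card_setU _ _) _; apply: leq_add; first exact: leq_imset_card.
apply: leq_trans (leq_card_setU _ _) _.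
by apply: leq_add; apply: leq_imset_card.
Qed.

Lemma is_free_delete_vertex F : is_free F G -> is_free F delete_vertex.
Proof. by apply: (@is_free_embedding F delete_vertex G val) => //; apply: val_inj. Qed.
End DeleteVertex.

(** * The number of edges of free graphs *)

(** The arithmetic of deleting a vertex of degree [g] from a graph with [m] vertices
    and [e] pairs, leaving [e'] pairs: if the deletion restores the bound
    [e ^ p <= C * m ^ q], then [g] is at least half of the average degree [e / m],
    because the proportion of pairs that is lost exceeds [1 / m]. *)
Lemma degree_lower_bound (p q C m e e' g : nat) :
  0 < p -> p <= q -> 0 < m -> e <= e' + 2 * g ->
  e' ^ p <= C * m.-1 ^ q -> C * m ^ q < e ^ p -> e <= 2 * m * g.
Proof.
move=> p0 pq m0 ee' small big; rewrite leqNgt; apply/negP => lt.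
have lt2 : e * m.-1 < e' * m by case: m m0 lt {small big} => //= m _; nia.
have e'0 : 0 < e' by case: (e') lt2; rewrite ?mul0n.
have q0 := leq_trans p0 pq.
have [m1|m1] := posnP m.-1.
  by move: small; rewrite m1 exp0n // muln0 leqn0 expn_eq0; lia.
have : (e * m.-1) ^ p * m.-1 ^ (q - p) <= (e' * m) ^ p * m ^ (q - p).
  apply: leq_mul; first by rewrite leq_exp2r // ltnW.
  by have [->|qp] := posnP (q - p); rewrite // leq_exp2r // leq_pred.
rewrite !expnMn -!mulnA -!expnD subnKC // leqNgt => /negP[].
apply: (@leq_ltn_trans (C * m.-1 ^ q * m ^ q)); first exact: leq_mul.
by rewrite mulnAC ltn_mul2r big expn_gt0 m1.
Qed.

(** A free graph violating the bound and minimal for this has all degrees at least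
    half of the average. Greedy embedding then gives about [m * (e / m) ^ d] copies
    of [T], against the upper bound [K * e ^ k]; comparing both gives back the
    bound on [e]. Minimality thus replaces any regularization of the graph: no
    control of the maximum degree is used. *)
Lemma edge_bound (T : sgraph) (s : seq T) (F : sgraph -> Prop) k d K :
  tree_order s -> (forall x, x \in s) -> 0 < k -> k < d -> d < #|T| ->
  (forall G, is_free F G -> #|embeddings T G| <= K * #|adj_pairs G| ^ k) ->
  exists C, forall G, is_free F G ->
    #|adj_pairs G| ^ (d - k) <= C * #|G| ^ d.-1.
Proof.
move=> sT sA k0 kd dT count.
have dk : 0 < d - k by rewrite subn_gt0.
have dkd : d - k <= d.-1 by lia.
(* The second summand makes the degrees exceed [2 * #|T|], so that removing the
   used vertices costs at most half of each neighbourhood. *)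
pose C := 4 ^ d * K + (4 * #|T|) ^ (d - k); exists C => G.
have [n] := ubnP #|G|; elim: n G => // n IH G Gn GF.
set m := #|G|; set e := #|adj_pairs G|.
rewrite leqNgt; apply/negP => big.
have e0 : 0 < e by case: (e) big; rewrite // exp0n.
have [v1 _] : exists v : G, true.
  by have /card_gt0P[[x _] _] := e0; exists x.
have m0 : 0 < m by apply/card_gt0P; exists v1.
have deg (v : G) : e <= 2 * m * degree v.
  apply: (degree_lower_bound dk dkd m0 (adj_pairs_delete_vertex v) _ big).
  rewrite -/m -(card_delete_vertex v); apply: IH.
    by rewrite card_delete_vertex -/m; move: Gn m0; rewrite -/m; lia.
  exact: is_free_delete_vertex.
have dense : 4 * #|T| * m < e.
  rewrite -(ltn_exp2r _ _ dk); apply: leq_ltn_trans big.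
  rewrite expnMn; apply: leq_mul; first exact: leq_addl.
  by rewrite leq_pexp2l.
case: (@arg_minnP _ v1 predT (@degree G) isT) => v _ vmin.
pose D := degree v - #|T|.
have degT : 2 * #|T| < degree v by have := deg v; nia.
have embG : m * D ^ #|T|.-1 <= K * e ^ k.
  apply: leq_trans (count G GF); apply: (leq_card_embeddings sT sA).
    by lia.
  by move=> w; have := vmin w isT; rewrite /D; lia.
have eD : e <= 4 * m * D.
  by apply: leq_trans (deg v) _; rewrite /D; nia.
have D0 : 0 < D by rewrite /D; lia.
have : m * e ^ d <= m * ((4 * m) ^ d * D ^ #|T|.-1).
  rewrite leq_mul2l; apply/orP; right.
  apply: (@leq_trans ((4 * m * D) ^ d)); first by rewrite leq_exp2r //; lia.
  by rewrite expnMn leq_mul2l leq_pexp2l ?orbT //; lia.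
rewrite mulnCA => /leq_trans/(_ (leq_mul (leqnn _) embG)).
have {1}-> : d = (d - k) + k by rewrite subnK // ltnW.
rewrite expnD !mulnA leq_mul2r expn_eq0 eqn0Ngt e0 /=.
rewrite leqNgt => /negP[].
apply: (@leq_ltn_trans (m * (4 ^ d * K * m ^ d.-1))).
  have Em : m ^ d = m * m ^ d.-1 by rewrite -expnS prednK //; lia.
  by rewrite expnMn Em mulnCA -mulnA [_ * K]mulnAC.
rewrite ltn_mul2l m0; apply: leq_ltn_trans big.
by rewrite leq_mul2r leq_addr orbT.
Qed.

(** The exponent arises as follows: copies number at most [K * e ^ k], while
    [e ^ (d - k)] is at most [C * n ^ d.-1]. *)
Lemma extremal_bound (T : sgraph) (F : sgraph -> Prop) k d :
  is_tree T -> 0 < k -> k < d -> d < #|T| ->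
  (forall K, exists N, forall n, N <= n -> K * extremal n T F <= n ^ k.+1) ->
  exists C, forall n, extremal n T F ^ (d - k) <= C * n ^ (k * d.-1).
Proof.
move=> Ttree k0 kd dT small.
have [s [sT sA]] := tree_orderP Ttree.
have [x0 _] : exists x : T, true.
  have /card_gt0P[x _] : 0 < #|T| by apply: leq_ltn_trans dT.
  by exists x.
have nbr (x : T) : exists y, adj x y.
  have [z zx] : exists z, z != x.
    apply/existsP; rewrite -negb_forall; apply/negP => /forallP Tx.
    suff : #|T| <= 1 by lia.
    by apply/card_le1_eqP => a b _ _; rewrite (eqP (Tx a)) (eqP (Tx b)).
  have [_ /(_ x z)/connectP[[|y p] /= xp zE] _] := Ttree.
    by rewrite zE eqxx in zx.
  by case/andP: xp => xy _; exists y.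
have [K HK] := card_embeddings_free x0 (tree_rankP sT sA) nbr small.
have [C HC] := edge_bound sT sA k0 kd dT HK.
exists (K ^ (d - k) * C ^ k) => n; rewrite /extremal.
apply: (big_ind (fun a => a ^ (d - k) <= K ^ (d - k) * C ^ k * n ^ (k * d.-1))).
- by rewrite exp0n // subn_gt0.
- by move=> a b Ha Hb; rewrite /maxn; case: ifP.
move=> E /asboolP EF.
have le1 := leq_trans (leq_copies_embeddings T _) (HK _ EF).
apply: (@leq_trans ((K * #|adj_pairs (edge_graph E)| ^ k) ^ (d - k))).
  by rewrite leq_exp2r // subn_gt0.
rewrite expnMn -mulnA leq_mul2l; apply/orP; right.
rewrite -expnM mulnC expnM [k * _]mulnC expnM -expnMn leq_exp2r //.
by have := HC _ EF; rewrite card_ord.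
Qed.

(** * Asymptotics *)

From mathcomp Require Import all_order all_algebra.
From mathcomp Require Import all_classical all_reals all_analysis.
Import Order.TTheory GRing.Theory Num.Theory.
Import numFieldNormedType.Exports.

Unset Implicit Arguments.
Set Strict Implicit.
Set Printing Implicit Defensive.

Local Open Scope classical_set_scope.
Local Open Scope ring_scope.

Lemma ltn_diameter (T : sgraph) : (0 < #|T|)%N -> (diameter T < #|T|)%N.
Proof.
move=> T0; rewrite -(prednK T0) ltnS; apply/bigmax_leqP => m _.
by rewrite -ltnS prednK.
Qed.

Lemma littleo_nat (R : realType) (f : nat -> nat) k :
  (fun n : nat => (f n)%:R : R) =o_\oo (fun n : nat => n%:R ^+ k : R) ->
  forall K, exists N, forall n, (N <= n)%N -> (K * f n <= n ^ k)%N.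
Proof.
move=> /eqoP fo K.
have K0 : (0 : R) < K.+1%:R^-1 by rewrite invr_gt0 ltr0n.
have [N _ HN] := fo _ K0; exists N => n Nn.
have := HN n Nn; rewrite /= !ger0_norm ?exprn_ge0 // mulrC ler_pdivlMr ?ltr0n //.
rewrite -natrX -natrM ler_nat mulnC; apply: leq_trans.
by rewrite leq_mul2r leqnSn orbT.
Qed.

Lemma bigO_nat_powR (R : realType) (f : nat -> nat) (p q C : nat) (a : R) :
  (0 < p)%N -> a = q%:R / p%:R -> (forall n, (f n ^ p <= C * n ^ q)%N) ->
  (fun n : nat => (f n)%:R : R) =O_\oo (fun n : nat => n%:R `^ a : R).
Proof.
(* The constant works because [C <= C.+1 ^ p]. *)
move=> p0 -> fC; apply/eqO_exP; exists C.+1%:R; first by rewrite ltr0n.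
apply: nearW => n /=; rewrite !ger0_norm ?powR_ge0 //.
rewrite -(ler_pXn2r p0) ?nnegrE ?mulr_ge0 ?powR_ge0 //.
rewrite exprMn -[(n%:R `^ _) ^+ p]powR_mulrn ?powR_ge0 // -powRrM.
rewrite divfK ?pnatr_eq0 -?lt0n // powR_mulrn // -!natrX -natrM ler_nat.
apply: leq_trans (fC n) _; rewrite leq_mul2r; apply/orP; right.
by apply: leq_trans (leqnSn C) _; rewrite -{1}[C.+1]expn1 leq_pexp2l.
Qed.

Theorem theorem1p7 (R : realType) (k : nat) (T : sgraph) (d : nat) :
  (1 <= k)%N -> is_tree T -> diameter T = d -> (2 * k <= d)%N ->
  forall F : sgraph -> Prop,
    (forall H : sgraph, F H -> edges H != finset.set0) ->
    (fun n : nat => (extremal n T F)%:R : R) =o_\oo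
      (fun n : nat => n%:R ^+ k.+1 : R) ->
    (fun n : nat => (extremal n T F)%:R : R) =O_\oo
      (fun n : nat =>
        n%:R `^ (k%:R + k%:R * (k%:R - 1) / (d%:R - k%:R)) : R).
Proof.
move=> k0 Ttree Td kd F _ /littleo_nat small.
have dT : (d < #|T|)%N by rewrite -Td; apply: ltn_diameter; case: Ttree.
have lt_kd : (k < d)%N by apply: leq_trans kd; rewrite mul2n -addnn -addn1 leq_add2l.
have [C HC] := extremal_bound Ttree k0 lt_kd dT small.
apply: (@bigO_nat_powR R _ _ _ _ _ _ _ HC); first by rewrite subn_gt0.
have dk0 : d%:R - k%:R != 0 :> R by rewrite subr_eq0 eqr_nat gtn_eqF.
rewrite natrM natrB ?(ltnW lt_kd) // -subn1 natrB ?(leq_ltn_trans _ lt_kd) //.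
by rewrite -[X in X + _](mulfK dk0) -mulrDl -mulrDr addrA subrK.
Qed.
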